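(* Let $n\ge 1$, let $\mathcal N=(N_1,\ldots,N_n)$ be a Grassmann necklace in $\binom{[n]}{r}$, let $X\in \mathcal{O}ut(\mathcal N)$ and let $Y\in \mathcal{I}nt(\mathcal N)$. Then $X$ and $Y$ are weakly separated, i.e. $X\| Y$.
   Context: $[n]=\{1,\ldots,n\}$, regarded as $\mathbb Z$ modulo $n$; $\binom{[n]}{r}$ is the set of $r$-element subsets of $[n]$. For $i\in[n]$, $<_i$ is the cyclically shifted order $i<_i i+1<_i\cdots<_i n<_i 1<_i\cdots<_i i-1$. For $X,Y\in\binom{[n]}{r}$, write $X\ll_i Y$ if $x<_i y$ for all $x\in X-Y$ and $y\in Y-X$ (set differences). $X$ and $Y$ are weakly separated, written $X\|Y$, if $X\ll_j Y$ for some $j\in[n]$. A (Grassmann) necklace in $\binom{[n]}{r}$ is a family $\mathcal N=(N_1,\ldots,N_n)$ of sets in $\binom{[n]}{r}$ such that $N_{i+1}\supseteq N_i-\{i\}$ for each $i$ (indices modulo $n$). Standing assumption: $i\in N_i$ for every $i\in[n]$. The interior of $\mathcal N$ is $\mathcal{I}nt(\mathcal N)=\{X\in\binom{[n]}{r} : N_i\ll_i X \text{ for every } i\in[n]\}$. Put $\mathcal S(\mathcal N)=\{X\in\binom{[n]}{r} : X\|N_i \text{ for all } i\in[n]\}$. One has $\mathcal{I}nt(\mathcal N)\subseteq\mathcal S(\mathcal N)$, and the exterior of $\mathcal N$ is $\mathcal{O}ut(\mathcal N)=\mathcal S(\mathcal N)\setminus\mathcal{I}nt(\mathcal N)$. 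*)

(* Defs.v *)
From mathcomp Require Import all_boot.
Set Implicit Arguments. Unset Strict Implicit. Unset Printing Implicit Defensive.

(* MathComp world.  The ground set [n] = Z/n is 'I_n, with the residues
   0, ..., n - 1 as representatives and ordS as the cyclic successor i + 1
   (so 0 plays the role of the label n). *)

(* (x + (n - i)) %% n is the position of x, counted from 0, in the list
   i, i + 1, ..., i - 1; the subtraction is never truncated as i < n. *)
Definition cyc_lt (n : nat) (i x y : 'I_n) : bool :=
  (x + (n - i)) %% n < (y + (n - i)) %% n.

Definition cyc_ll (n : nat) (i : 'I_n) (X Y : {set 'I_n}) : bool :=
  [forall x in X :\: Y, [forall y in Y :\: X, cyc_lt i x y]].

Definition weakly_separated (n : nat) (X Y : {set 'I_n}) : bool :=
  [exists j : 'I_n, cyc_ll j X Y].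

Definition rsubsets (n r : nat) : {set {set 'I_n}} :=
  [set X : {set 'I_n} | #|X| == r].

Definition necklace (n r : nat) (N : 'I_n -> {set 'I_n}) : Prop :=
  (forall i : 'I_n, N i \in rsubsets n r) /\
  (forall i : 'I_n, N i :\ i \subset N (ordS i)).

Definition neck_int (n r : nat) (N : 'I_n -> {set 'I_n}) : {set {set 'I_n}} :=
  [set X in rsubsets n r | [forall i : 'I_n, cyc_ll i (N i) X]].

Definition neck_sep (n r : nat) (N : 'I_n -> {set 'I_n}) : {set {set 'I_n}} :=
  [set X in rsubsets n r | [forall i : 'I_n, weakly_separated X (N i)]].

Definition neck_out (n r : nat) (N : 'I_n -> {set 'I_n}) : {set {set 'I_n}} :=
  neck_sep r N :\: neck_int r N.

(* Main.v *)
Require Import Defs.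
From mathcomp Require Import all_boot zify.

(* Compare X with N_k in the order <_k.  If X <> N_k, the differences X - N_k
   and N_k - X are nonempty and do not cross, so along the order they form one
   of the words NX (k is "inner": N_k <<_k X), XN ("outer": X <<_k N_k), NXN or
   XNX.  As k runs around the circle, one exchange N_k -> N_{k+1} at a time,
   the word can only change along the cycle NX -> NXN -> XN -> XNX -> NX,
   possibly skipping NXN or XNX, and it cannot avoid NX forever.
   Hence if X is not interior there are s < p < e with s and e inner, p outer,
   only NXN strictly between s and p, and no NX or NXN from p to e - 1.

   Then X <<_p Y.  Otherwise v <_p u for some u in X - Y and v in Y - X.  For k
   in a suitable range around p, N_k contains both or neither of u and v:
   u without v contradicts N_k <<_k Y, and v without u contradicts the shape of
   the word at k together with X <<_p N_p.  At the left end of the range N_k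
   contains neither, at the right end both, but each step adds only one
   element. *)

Set Implicit Arguments.
Unset Strict Implicit.

(* The circle is unrolled: k and x range over nat, M k x stands for the
   membership of x mod n in N_(k mod n), and the order <_k is the usual order on
   the window [k, k + n). *)
Section Unrolled.

Context (n : nat) (X Y : nat -> bool) (M : nat -> nat -> bool).

(** * The differences of X and N_k in a window, and the shapes of their word *)

Definition lost k x := [&& k <= x < k + n, X x & ~~ M k x].
Definition extra k x := [&& k <= x < k + n, M k x & ~~ X x].

(** Bounding by ordinals keeps this boolean, so that least indices can be taken; [lost k] and
    [extra k] live below [k + n] anyway. *)
Definition precedes k (A B : nat -> bool) :=
  [forall x : 'I_(k + n), [forall y : 'I_(k + n), A x ==> (B y ==> (x < y))]].

Definition inner k := precedes k (extra k) (lost k).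
Definition outer k := precedes k (lost k) (extra k).
(** For an uncrossed word this means XN or XNX, and [ends_extra] means XN or NXN. *)
Definition starts_lost k := exists2 x, lost k x & forall y, extra k y -> x < y.
Definition ends_extra k := exists2 y, extra k y & forall x, lost k x -> x < y.

Hypothesis X_per : forall x, X (x + n) = X x.
Hypothesis M_perl : forall k x, M (k + n) x = M k x.
Hypothesis M_perr : forall k x, M k (x + n) = M k x.
Hypothesis M_diag : forall k, M k k.
Hypothesis M_step : forall k x, M k x -> k < x < k + n -> M k.+1 x.
(** One element enters per step. The guards let [k + n], the next copy of [k], count as the entering
    element when [k] is kept. *)
Hypothesis M_new : forall k x y,
  k < x <= k + n -> k < y <= k + n -> M k.+1 x -> M k.+1 y ->
  (x < k + n -> ~~ M k x) -> (y < k + n -> ~~ M k y) -> x = y.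
Hypothesis lost_ex : forall k, exists x, lost k x.
Hypothesis extra_ex : forall k, exists x, extra k x.
Hypothesis lost_two : forall k x y z, extra k x -> extra k y -> x <> y ->
  exists2 t, lost k t & t <> z.
Hypothesis extra_two : forall k x y z, lost k x -> lost k y -> x <> y ->
  exists2 t, extra k t & t <> z.
Hypothesis no_lele : forall k a b c d, lost k a -> extra k b -> lost k c ->
  extra k d -> ~ (a < b < c /\ c < d).
Hypothesis no_elel : forall k a b c d, extra k a -> lost k b -> extra k c ->
  lost k d -> ~ (a < b < c /\ c < d).
Hypothesis Y_inner : forall k x y, k <= x < k + n -> k <= y < k + n ->
  M k x -> ~~ Y x -> Y y -> ~~ M k y -> x < y.
Hypothesis Y_last : forall k x, x.+1 = k + n -> M k x -> Y x.

(* [lia] would split on the truth values of the cleared hypotheses. *)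
Ltac order :=
  repeat match goal with
  | H : is_true (X _) |- _ => clear H
  | H : is_true (Y _) |- _ => clear H
  | H : is_true (M _ _) |- _ => clear H
  | H : is_true (~~ _) |- _ => clear H
  | H : is_true (lost _ _) |- _ => clear H
  | H : is_true (extra _ _) |- _ => clear H
  end; lia.

Lemma lostP k x : lost k x -> [/\ k <= x, x < k + n, X x & ~~ M k x].
Proof. by case/and3P=> /andP[]. Qed.

Lemma extraP k x : extra k x -> [/\ k <= x, x < k + n, M k x & ~~ X x].
Proof. by case/and3P=> /andP[]. Qed.

Lemma lostI k x : k <= x -> x < k + n -> X x -> ~~ M k x -> lost k x.
Proof. by move=> *; apply/and3P; split => //; apply/andP. Qed.

Lemma extraI k x : k <= x -> x < k + n -> M k x -> ~~ X x -> extra k x.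
Proof. by move=> *; apply/and3P; split => //; apply/andP. Qed.

Lemma innerP k : reflect (forall x y, lost k x -> extra k y -> y < x) (inner k).
Proof.
apply: (iffP forallP) => [h x y hx hy|h y].
  have [_ xn _ _] := lostP hx; have [_ yn _ _] := extraP hy.
  by have /forallP/(_ (Ordinal xn)) := h (Ordinal yn); rewrite /= hx hy.
by apply/forallP => x; apply/implyP => hy; apply/implyP => hx; apply: h.
Qed.

Lemma outerP k : reflect (forall x y, lost k x -> extra k y -> x < y) (outer k).
Proof.
apply: (iffP forallP) => [h x y hx hy|h x].
  have [_ xn _ _] := lostP hx; have [_ yn _ _] := extraP hy.
  by have /forallP/(_ (Ordinal yn)) := h (Ordinal xn); rewrite /= hx hy.
by apply/forallP => y; apply/implyP => hx; apply/implyP => hy; apply: h.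
Qed.

Lemma lost_neq_extra k x : lost k x -> ~ extra k x.
Proof. by case/lostP => _ _ _ /negP h /extraP []. Qed.

Lemma innerN k : ~~ inner k -> exists x y, [/\ lost k x, extra k y & x < y].
Proof.
case/forallPn => y /forallPn[x]; rewrite !negb_imply => /and3P[hy hx xy].
exists (val x), (val y); split => //=.
have: val x <> val y by move=> e; apply: (lost_neq_extra hx); rewrite e.
move: xy => /=; order.
Qed.

Lemma outerN k : ~~ outer k -> exists x y, [/\ lost k x, extra k y & y < x].
Proof.
case/forallPn => x /forallPn[y]; rewrite !negb_imply => /and3P[hx hy xy].
exists (val x), (val y); split => //=.
have: val x <> val y by move=> e; apply: (lost_neq_extra hx); rewrite e.
move: xy => /=; order.
Qed.

(** * One exchange step and its effect on the word *)

Lemma M_persist k l x : k <= l -> l <= x -> x < k + n -> M k x -> M l x.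
Proof.
move=> kl lx xn Mk; elim: l kl lx => [|l IH] kl lx.
  by move: Mk; have -> : k = 0 by order.
case: (leqP k l) => [kl'|lk]; last by have <- : k = l.+1 by order.
by apply: M_step; [apply: IH; order | order].
Qed.

Lemma starts_lost_first k x : lost k x -> (forall y, extra k y -> x < y) -> X k.
Proof.
move=> hx h; apply/negPn/negP => Xk.
have [kx xn _ _] := lostP hx.
have /h : extra k k by apply: extraI => //; order.
order.
Qed.

Lemma lost_back k x : x <> k + n -> lost k.+1 x -> lost k x.
Proof.
move=> xk /lostP[kx xn Xx Mx]; apply: lostI => //; try order.
apply: contra Mx => Mx; apply: M_step => //; order.
Qed.

Lemma lost_next k x y : lost k x -> k < y <= k + n -> M k.+1 y ->
  (y < k + n -> ~~ M k y) -> y <> x -> lost k.+1 x.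
Proof.
move=> /lostP[kx xn Xx Mx] ky My My' yx.
have xk : x <> k by move=> e; rewrite e M_diag in Mx.
apply: lostI => //; try order.
apply/negP => Mx'; apply: yx; apply: (M_new (k := k)) => //; order.
Qed.

Lemma extra_next k y : extra k y -> k <> y -> extra k.+1 y.
Proof.
move=> /extraP[ky yn My Xy] yk; apply: extraI => //; try order.
apply: M_step => //; order.
Qed.

Lemma extra_back k y z : extra k.+1 y -> y <> z -> k < z <= k + n -> M k.+1 z ->
  (z < k + n -> ~~ M k z) -> extra k y.
Proof.
move=> /extraP[ky yn My Xy] yz kz Mz Mz'.
have [Mky|Mky] := boolP ((y < k + n) && M k y).
  by case/andP: Mky => *; apply: extraI => //; order.
case: yz; apply: (M_new (k := k)) => //; lia.
Qed.

(* [M k.+1 (k + n)] says that [k] is not removed at step [k]; then nothing else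
   changes either. *)
Lemma fixed_lost k x : M k.+1 (k + n) -> lost k.+1 x <-> lost k x.
Proof.
move=> Mk; split => [hx|hx].
  apply: lost_back => // e; case/lostP: hx => _ _ _; by rewrite e Mk.
have [kx xn _ _] := lostP hx.
by apply: (lost_next (y := k + n) hx) => //; order.
Qed.

Lemma fixed_extra k y : X k -> M k.+1 (k + n) -> extra k.+1 y <-> extra k y.
Proof.
move=> Xk Mk; split => [hy|hy].
  have [ky yn _ _] := extraP hy.
  apply: (extra_back (z := k + n) hy) => //; try order.
  by move=> e; case/extraP: hy => _ _ _; rewrite e X_per Xk.
by apply: extra_next => // e; case/extraP: hy => _ _ _; rewrite -e Xk.
Qed.

(** If [k] is removed, it returns as the lost element [k + n] closing the new window; an extra
    element in front of the lost [x] would then spell NXNX. *)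
Lemma starts_lost_step k : starts_lost k -> ~~ inner k.+1 -> starts_lost k.+1.
Proof.
move=> [x0 hx0 h0] /innerN [x [y [hx hy xy]]].
have Xk := starts_lost_first hx0 h0.
have [Mk|Mk] := boolP (M k.+1 (k + n)).
  exists x0; first exact/fixed_lost.
  by move=> z hz; apply: h0; apply/fixed_extra.
exists x => // z hz; rewrite ltnNge; apply/negP => zx.
have hkn : lost k.+1 (k + n).
  have [kx xn _ _] := lostP hx.
  by apply: lostI => //; try order; rewrite X_per.
have zx' : z <> x by move=> e; apply: (lost_neq_extra hx); rewrite -e.
have yk : y <> k + n by move=> e; apply: (lost_neq_extra hkn); rewrite -e.
have [ky yn _ _] := extraP hy.
apply: (no_elel hz hx hy hkn); order.
Qed.

(** Were [k] removed, [k + n] would become lost behind a surviving NXN, giving NXNX at [k.+1]. *)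
Lemma middle_fixed k x y z : extra k x -> lost k y -> extra k z ->
  x < y < z -> X k -> M k.+1 (k + n).
Proof.
move=> hx hy hz xyz Xk; apply/negPn/negP => Mk.
have hkn : lost k.+1 (k + n).
  have [kx xn _ _] := lostP hy.
  by apply: lostI => //; try order; rewrite X_per.
have hnk t : extra k t -> k <> t.
  by move=> /extraP[_ _ _ h] e; move: h; rewrite -e Xk.
have hx' := extra_next hx (hnk _ hx).
have hz' := extra_next hz (hnk _ hz).
(* The middle [y] may itself be the entering element; a second lost element then stays lost, and
   uncrossedness at [k] puts it between [x] and [z]. *)
have [t ht] : exists2 t, lost k t & lost k.+1 t.
  have [yl|yl] := boolP (lost k.+1 y); first by exists y.
  have [t ht ty] := lost_two y hx hz ltac:(order).
  exists t => //.
  have [ky yn Xy My] := lostP hy.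
  have yk : y <> k by move=> e; rewrite e M_diag in My.
  apply: (lost_next (y := y) ht) => //; try order.
  by apply: contraR yl => My'; apply: lostI => //; order.
move=> ht'.
have tx : t <> x by move=> e; apply: (lost_neq_extra ht); rewrite e.
have tz : t <> z by move=> e; apply: (lost_neq_extra ht); rewrite e.
have [kz zn _ _] := extraP hz.
have [kt tn _ _] := lostP ht.
case: (ltnP t x) => tx'; first by apply: (no_lele ht hx hy hz); order.
case: (ltnP z t) => tz'; first by apply: (no_elel hx hy hz ht); order.
apply: (no_elel hx' ht' hz' hkn); order.
Qed.

Lemma not_outer_middle k : ends_extra k -> ~~ outer k ->
  exists x y z, [/\ extra k x, lost k y, extra k z & x < y < z].
Proof.
move=> [z hz hl] /outerN [y [x [hy hx xy]]].
exists x, y, z; split => //; have := hl _ hy; order.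
Qed.

(** If [k] is in X, [middle_fixed] shows that nothing changes. If not, no element becomes lost, and
    the last extra element comes after a lost one, so it is not [k] and persists. *)
Lemma ends_extra_step k : ends_extra k -> ~~ outer k -> ends_extra k.+1.
Proof.
move=> hE hO; have [x [y [z [hx hy hz xyz]]]] := not_outer_middle hE hO.
case: hE => t ht hl.
have [Xk|Xk] := boolP (X k).
  have Mk := middle_fixed hx hy hz xyz Xk.
  exists t; first exact/fixed_extra.
  by move=> s hs; apply: hl; apply/fixed_lost.
have [ky _ _ _] := lostP hy.
exists t; first by apply: extra_next => //; have := hl _ hy; order.
move=> s hs; apply: hl; apply: lost_back => // e.
by case/lostP: hs => _ _; rewrite e X_per => /(negP Xk).
Qed.

Lemma inner_step k : inner k -> ~~ inner k.+1 -> ends_extra k.+1.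
Proof.
move=> /innerP hI hN.
have [x [y [hx hy xy]]] := innerN hN.
have [q hq] := extra_ex k.
have [ky yn My Xy] := extraP hy.
have [kx xn _ _] := lostP hx.
have [Xk|Xk] := boolP (X k).
  have qk : k <> q by move=> e; case/extraP: hq => _ _ _; rewrite -e Xk.
  have [Mk|Mk] := boolP (M k.+1 (k + n)).
    case/negP: hN; apply/innerP => s t hs ht.
    by apply: hI; [exact/fixed_lost | exact/fixed_extra].
  have hx' : lost k x by apply: lost_back hx; order.
  have yk : y <> k + n by move=> e; move: My; rewrite e => My; rewrite My in Mk.
  case: (no_elel (extra_next hq qk) hx hy (d := k + n)).
    by apply: lostI => //; try order; rewrite X_per.
  have := hI _ _ hx' hq; order.
have hback s : lost k.+1 s -> lost k s.
  move=> hs; apply: lost_back => // e.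
  by case/lostP: hs => _ _; rewrite e X_per => /(negP Xk).
(* Here [y] must be the entering element. A lost [s] beyond it would force, by cardinality, another
   extra [t]; this one is old, hence before [x], and [t], [x], [y], [s] spell NXNX. *)
exists y => // s hs; rewrite ltnNge; apply/negP => ys.
have sy : s <> y by move=> e; apply: (lost_neq_extra hs); rewrite e.
have [t ht ty] : exists2 t, extra k.+1 t & t <> y.
  by apply: (extra_two y hx hs); order.
have ht' : extra k t.
  apply: (extra_back (z := y)) => //; try order.
  move=> yk; apply/negP => My'.
  have /(hI _ _ (hback _ hx)) : extra k y by apply: extraI => //; order.
  order.
have := hI _ _ (hback _ hx) ht'.
move=> tx; apply: (no_elel ht hx hy hs); order.
Qed.

(** * Going round the circle *)

Lemma reach_outer k : ends_extra k ->
  exists2 p, k <= p & outer p /\ forall l, k <= l <= p -> ends_extra l.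
Proof.
move=> hE.
have hEl p : (forall l, k <= l < p -> ~~ outer l) ->
    forall l, k <= l <= p -> ends_extra l.
  move=> hN; elim=> [|l IH] hl; first by have <- : k = 0 by order.
  case: (leqP k l) => [kl|lk]; last by have <- : k = l.+1 by order.
  by apply: ends_extra_step; [apply: IH; order | apply: hN; order].
suff : exists p, (k <= p) && outer p.
  case/ex_minnP => p /andP[kp hp] pmin; exists p => //; split => //.
  apply: hEl => l hl; apply/negP => ho.
  by have := pmin l; rewrite ho; order.
have [hh|hN] := boolP (has outer (iota k n.+1)).
  case/hasP: hh => p; rewrite mem_iota => hp ho; exists p; rewrite ho; order.
have {}hN l : k <= l <= k + n -> ~~ outer l.
  move=> hl; apply/negP => ho; case/hasP: hN; exists l => //.
  by rewrite mem_iota; order.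
(* If NXN lasted a full turn, this lost [x] would be kept when the index passes it, and [x + n]
   would remain until index [k + n], so by periodicity [x] would lie in N_k. *)
have [x hx] := lost_ex k; have [kx xn Xx /negP[]] := lostP hx.
have /(@not_outer_middle x) : ends_extra x.
  by apply: (hEl x) => [l hl|]; [apply: hN|]; order.
case=> [|a [b [c [ha hb hc abc]]]]; first by apply: hN; order.
have Mx := middle_fixed ha hb hc abc Xx.
rewrite -(M_perr k x) -(M_perl k (x + n)).
by apply: (M_persist (k := x.+1)) => //; order.
Qed.

Lemma reach_inner p : starts_lost p ->
  exists2 e, p < e & inner e /\ forall l, p <= l < e -> starts_lost l.
Proof.
move=> hB.
have hBl e : (forall l, p < l < e -> ~~ inner l) ->
    forall l, p <= l < e -> starts_lost l.
  move=> hN; elim=> [|l IH] hl; first by have <- : p = 0 by order.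
  case: (leqP p l) => [kl|lk]; last by have <- : p = l.+1 by order.
  by apply: starts_lost_step; [apply: IH; order | apply: hN; order].
suff : exists e, (p < e) && inner e.
  case/ex_minnP => e /andP[pe he] emin; exists e => //; split => //.
  apply: hBl => l hl; apply/negP => hi.
  by have := emin l; rewrite hi; order.
have [hh|hN] := boolP (has inner (iota p.+1 n)).
  case/hasP: hh => e; rewrite mem_iota => hp ho; exists e; rewrite ho; order.
have {}hN l : p < l <= p + n -> ~~ inner l.
  move=> hl; apply/negP => ho; case/hasP: hN; exists l => //.
  by rewrite mem_iota; order.
(* This [x] is outside X, yet a word starting with X at index [x] would force [x] into X. *)
have [x hx] := extra_ex p; have [kx xn _ /negP[]] := extraP hx.
have [l hl h] : starts_lost x.
  by apply: (hBl (p + n)) => [l hl|]; [apply: hN|]; order.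
exact: starts_lost_first hl h.
Qed.

Lemma outer_starts_lost p : outer p -> starts_lost p.
Proof.
move=> /outerP h; have [x hx] := lost_ex p.
by exists x => // y hy; apply: h.
Qed.

Lemma lost_per k x : lost (k + n) (x + n) = lost k x.
Proof. by rewrite /lost X_per M_perl M_perr; congr (_ && _); order. Qed.

Lemma extra_per k x : extra (k + n) (x + n) = extra k x.
Proof. by rewrite /extra X_per M_perl M_perr; congr (_ && _); order. Qed.

Lemma inner_per k : inner (k + n) -> inner k.
Proof.
move=> /innerP h; apply/innerP => x y; rewrite -lost_per -extra_per => hx hy.
have := h _ _ hx hy; order.
Qed.

(** NXN leads to an outer index, where the word starts with X; XN and XNX start so already. From
    there [reach_inner] applies. *)
Lemma not_inner_reach b : ~~ inner b -> exists2 e, b < e & inner e.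
Proof.
move=> hb; have [x [y [hx hy xy]]] := innerN hb.
suff [p bp /reach_inner [e pe [he _]]] : exists2 p, b <= p & starts_lost p.
  by exists e => //; order.
have [hq|hq] := boolP (has (fun q => extra b q && (q < x)) (iota b n)).
  have {hq} [q hq qx] : exists2 q, extra b q & q < x.
    by case/hasP: hq => q _ /andP[]; exists q.
  have hE : ends_extra b.
    exists y => // z hz; rewrite ltnNge; apply/negP => yz.
    have : z <> y by move=> e; apply: (lost_neq_extra hz); rewrite e.
    by move=> zy; apply: (no_elel hq hx hy hz); order.
  have [p bp [hp _]] := reach_outer hE.
  by exists p => //; apply: outer_starts_lost.
exists b => //; exists x => // z hz; rewrite ltnNge; apply/negP => zx.
have zx' : z <> x by move=> e; apply: (lost_neq_extra hx); rewrite -e.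
have [kz zn _ _] := extraP hz.
case/hasP: hq; exists z; first by rewrite mem_iota; order.
rewrite hz; order.
Qed.

Lemma not_inner_last b : ~~ inner b -> exists2 s, inner s & ~~ inner s.+1.
Proof.
move=> hb; have [e be he] := not_inner_reach hb.
have n0 : 0 < n.
  have [x hx] := lost_ex b; have [] := lostP hx; order.
have hbm m : ~~ inner (b + m * n).
  elim: m => [|m IH]; first by rewrite addn0.
  by apply: contra IH; rewrite mulSn addnCA addnC; apply: inner_per.
(* By periodicity the failure at [b] recurs beyond [e]; the predecessor of the first recurrence is
   the desired [s]. *)
have : exists k, (e < k) && ~~ inner k.
  by exists (b + e.+1 * n); rewrite hbm andbT; nia.
case/ex_minnP => [[|s]] // /andP[es hs] smin; exists s => //.
apply/negPn/negP => hsN.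
have es' : e <> s by move=> h; move: hsN; rewrite -h he.
have := smin s; rewrite hsN; order.
Qed.

(** * Inverted pairs and the separating position *)

Lemma lost_extra_ltgt k x y : lost k x -> extra k y -> x < y \/ y < x.
Proof.
move=> hx hy; have : x <> y by move=> e; apply: (lost_neq_extra hx); rewrite e.
order.
Qed.

(** If [p <= v], then [v] is still extra at [p], so some lost [x] at [p] precedes it. This [x] is
    already lost at [k], where the shape puts every lost element after [v]. *)
Lemma inverted_before k p u v : k <= p -> outer p -> inner k \/ ends_extra k ->
  lost k u -> extra k v -> v < u -> v < p.
Proof.
move=> kp /outerP hp hk hu hv vu; rewrite ltnNge; apply/negP => pv.
have hvP x : lost k x -> v < x.
  move=> hx; case: (lost_extra_ltgt hx hv) => // xv.
  case: hk => [/innerP h|[q hq hl]]; first by have := h _ _ hx hv; order.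
  by case: (no_lele hx hv hu hq); have := hl _ hu; order.
have [kv vn Mv Xv] := extraP hv.
have hv' : extra p v.
  by apply: extraI => //; [order | apply: (M_persist (k := k))].
have [x hx] := lost_ex p; have [px xn Xx Mx] := lostP hx.
have xv := hp _ _ hx hv'.
have /hvP : lost k x; last by order.
apply: lostI => //; try order.
by apply: contra Mx => Mx; apply: (M_persist (k := k)) => //; order.
Qed.

(** Mirror image: if [u < p + n], then [u] is already lost at [p], and an extra [q] following it
    there persists to [k], where every extra element precedes [u]. *)
Lemma inverted_after k p u v : p <= k -> outer p -> inner k \/ starts_lost k ->
  lost k u -> extra k v -> v < u -> p + n <= u.
Proof.
move=> pk /outerP hp hk hu hv vu; rewrite leqNgt; apply/negP => up.
have huQ q : extra k q -> q < u.
  move=> hq; case: (lost_extra_ltgt hu hq) => // uq.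
  case: hk => [/innerP h|[x hx hl]]; first by have := h _ _ hu hq; order.
  by case: (no_lele hx hv hu hq); have := hl _ hv; order.
have [ku un Xu Mu] := lostP hu.
have hu' : lost p u.
  apply: lostI => //; first order.
  by apply: contra Mu => Mu; apply: (M_persist (k := p)).
have [q hq] := extra_ex p; have [pq qn Mq Xq] := extraP hq.
have uq := hp _ _ hu' hq.
have /huQ : extra k q; last by order.
apply: extraI => //; try order.
by apply: (M_persist (k := p)) => //; order.
Qed.

Lemma outer_separates : (exists b, ~~ inner b) -> exists p, forall u v,
  p <= u < p + n -> p <= v < p + n -> X u -> ~~ Y u -> Y v -> ~~ X v -> u < v.
Proof.
case=> b /not_inner_last [s hs hs1].
have [p sp [hp hE]] := reach_outer (inner_step hs hs1).
have [e pe [he hB]] := reach_inner (outer_starts_lost hp).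
exists p => u v hu hv Xu Yu Yv Xv; rewrite ltnNge; apply/negP => vu'.
have {vu'} vu : v < u.
  have : v <> u by move=> h; move: Xv; rewrite h Xu.
  order.
(* The range stays between the inner indices [s] and [e] and keeps both [u] and [v] in the window:
   [k <= v] and [u < k + n]. *)
pose k0 := maxn (u.+1 - n) s; pose k1 := minn v e.
have eqM k : k0 <= k <= k1 -> M k u = M k v.
  move=> hk; apply/idP/idP => Mk; apply/negPn/negP => Mk'.
    have : u < v by apply: (Y_inner (k := k)) => //; order.
    order.
  have hku : lost k u by apply: lostI => //; order.
  have hkv : extra k v by apply: extraI => //; order.
  case: (ltngtP k p) => kp.
  - have := inverted_before (ltnW kp) hp _ hku hkv vu.
    have [->|/eqP ks] := eqVneq k s; first by move/(_ (or_introl hs)); order.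
    have /hE hEk : s < k <= p by order.
    by move/(_ (or_intror hEk)); order.
  - have := inverted_after (ltnW kp) hp _ hku hkv vu.
    have [->|/eqP ke] := eqVneq k e; first by move/(_ (or_introl he)); order.
    have /hB hBk : p <= k < e by order.
    by move/(_ (or_intror hBk)); order.
  - by move/outerP: hp; rewrite -kp => /(_ _ _ hku hkv); order.
have M0 : ~~ M k0 u.
  apply/negP => Mu.
  (* Either [u] closes the window of [k0], and [Y_last] would put it in Y, or [k0 = s]. *)
  have [h|h] := leqP (s + n) u.+1.
    have /Y_last : u.+1 = k0 + n by order.
    by move/(_ Mu); exact/negP.
  have e0 : k0 = s by order.
  have Mv : M s v by rewrite -e0 -eqM //; order.
  have hv' : extra s v by apply: extraI => //; order.
  have [x hx] := lost_ex s.
  have xv : v < x by move/innerP: hs; apply.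
  have := inverted_before (ltnW sp) hp (or_introl hs) hx hv' xv; order.
have M1 : M k1 v.
  have [h|h] := leqP v e; first by have -> : k1 = v by order.
  have e1 : k1 = e by order.
  rewrite -eqM; last order.
  apply/negPn/negP; rewrite e1 => Mu.
  have hu' : lost e u by apply: lostI => //; order.
  have [y hy] := extra_ex e.
  have yu : y < u by move/innerP: he; apply.
  have := inverted_after (ltnW pe) hp (or_introl he) hu' hy yu; order.
(* By [eqM], [u] could only enter together with [v], but one element enters per step. *)
have : forall k, k0 <= k <= k1 -> ~~ M k u.
  elim=> [|k IH] hk; first by have <- : k0 = 0 by order.
  case: (leqP k0 k) => kk; last by have <- : k0 = k.+1 by order.
  have Mk : ~~ M k u by apply: IH; order.
  have Mk' : ~~ M k v by rewrite -eqM //; order.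
  apply/negP => Mu.
  have Mv : M k.+1 v by rewrite -eqM.
  have : u = v by apply: (M_new (k := k)) => //; order.
  order.
move/(_ k1); rewrite eqM; last order.
by rewrite M1 => /(_ ltac:(order)).
Qed.

End Unrolled.

(** * Integer windows and the cyclic orders *)

Section Residues.

Context (n : nat).
Hypothesis n_gt0 : 0 < n.

Definition residue k : 'I_n := Ordinal (ltn_pmod k n_gt0).

Lemma residue_per k : residue (k + n) = residue k.
Proof. by apply: val_inj; rewrite /= modnDr. Qed.

Lemma ordS_residue k : ordS (residue k) = residue k.+1.
Proof. by apply: val_inj; rewrite /= -addn1 modnDml addn1. Qed.

Lemma residue_val (z : 'I_n) : residue z = z.
Proof. by apply: val_inj; rewrite /= modn_small. Qed.

Lemma residue_pos k x : k <= x < k + n ->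
  (residue x + (n - residue k)) %% n = x - k.
Proof.
move=> /andP[kx xn]; rewrite /= modnDml.
have kn : k %% n < n by rewrite ltn_mod.
have -> : x + (n - k %% n) = k %/ n * n + (x - k + n).
  by have := divn_eq k n; lia.
by rewrite modnMDl modnDr modn_small //; lia.
Qed.

Lemma residue_inj k x y : k <= x < k + n -> k <= y < k + n ->
  residue x = residue y -> x = y.
Proof.
move=> hx hy e; have := residue_pos hx; rewrite e residue_pos //; lia.
Qed.

Lemma residue_surj k z : exists2 x, k <= x < k + n & residue x = z.
Proof.
have kn : k %% n < n by rewrite ltn_mod.
exists (k + (z + (n - k %% n)) %% n).
  have := ltn_pmod (z + (n - k %% n)) n_gt0; lia.
apply: val_inj; rewrite /= modnDmr.
have -> : k + (z + (n - k %% n)) = k %/ n * n + (z + n).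
  by have := divn_eq k n; lia.
by rewrite modnMDl modnDr modn_small.
Qed.

Lemma cyc_llP k (A B : {set 'I_n}) :
  reflect (forall x y, k <= x < k + n -> k <= y < k + n ->
             residue x \in A :\: B -> residue y \in B :\: A -> x < y)
          (cyc_ll (residue k) A B).
Proof.
apply: (iffP forall_inP) => [h x y hx hy Ax By|h z Az].
  have /forall_inP/(_ _ By) := h _ Ax.
  rewrite /cyc_lt !residue_pos //; lia.
apply/forall_inP => t Bt.
have [x hx ex] := residue_surj k z; have [y hy ey] := residue_surj k t.
rewrite -ex -ey /cyc_lt !residue_pos //.
have := h x y hx hy; rewrite ex ey => /(_ Az Bt); lia.
Qed.

(* Cutting the circle at [j] instead of [k] moves the representatives of the
   points before [j] up by [n]. *)
Lemma cyc_ll_recut k j (A B : {set 'I_n}) x y :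
  k <= j < k + n -> cyc_ll (residue j) A B ->
  k <= x < k + n -> k <= y < k + n ->
  residue x \in A :\: B -> residue y \in B :\: A ->
  (if x < j then x + n else x) < (if y < j then y + n else y).
Proof.
move=> hj /cyc_llP h hx hy Ax By.
have shift z : residue (if z < j then z + n else z) = residue z.
  by case: ifP => _ //; rewrite residue_per.
have window z : k <= z < k + n -> j <= (if z < j then z + n else z) < j + n.
  by move=> hz; case: ifP; lia.
by apply: h; rewrite ?shift //; apply: window.
Qed.

(** Wherever the circle is cut, the four points still alternate, so some point of [B :\: A] precedes
    one of [A :\: B]. *)
Lemma weakly_separated_uncrossed k (A B : {set 'I_n}) a b c d :
  weakly_separated A B -> k <= a -> a < b -> b < c -> c < d -> d < k + n ->
  residue a \in A :\: B -> residue b \in B :\: A ->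
  residue c \in A :\: B -> residue d \in B :\: A -> False.
Proof.
case/existsP => j0; have [j hj <-] := residue_surj k j0.
move=> h ka ab bc cd dn Aa Bb Ac Bd.
have cut := cyc_ll_recut hj h.
have := cut a d ltac:(lia) ltac:(lia) Aa Bd.
have := cut c b ltac:(lia) ltac:(lia) Ac Bb.
have := cut c d ltac:(lia) ltac:(lia) Ac Bd.
have := cut a b ltac:(lia) ltac:(lia) Aa Bb.
clear -hj ka ab bc cd dn; do 4 case: ifP; lia.
Qed.

Lemma weakly_separated_uncrossed_r k (A B : {set 'I_n}) a b c d :
  weakly_separated A B -> k <= a -> a < b -> b < c -> c < d -> d < k + n ->
  residue a \in B :\: A -> residue b \in A :\: B ->
  residue c \in B :\: A -> residue d \in A :\: B -> False.
Proof.
case/existsP => j0; have [j hj <-] := residue_surj k j0.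
move=> h ka ab bc cd dn Ba Ab Bc Ad.
have cut := cyc_ll_recut hj h.
have := cut b a ltac:(lia) ltac:(lia) Ab Ba.
have := cut b c ltac:(lia) ltac:(lia) Ab Bc.
have := cut d a ltac:(lia) ltac:(lia) Ad Ba.
have := cut d c ltac:(lia) ltac:(lia) Ad Bc.
clear -hj ka ab bc cd dn; do 4 case: ifP; lia.
Qed.

End Residues.

(** * Differences of sets of equal size *)

Lemma cards_setD_sym (T : finType) (A B : {set T}) :
  #|A| = #|B| -> #|A :\: B| = #|B :\: A|.
Proof.
move=> h; have := cardsID B A; have := cardsID A B; rewrite setIC h; lia.
Qed.

Lemma setD_ex_neq (T : finType) (A B : {set T}) x y z : #|A| = #|B| ->
  x \in A :\: B -> y \in A :\: B -> x != y -> exists2 t, t \in B :\: A & t != z.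
Proof.
move=> /cards_setD_sym h hx hy xy.
have : 1 < #|B :\: A| by rewrite -h; apply/card_gt1P; exists x, y.
case/card_gt1P => s [t [hs ht st]].
have [sz|sz] := eqVneq s z; last by exists s.
by exists t => //; rewrite -sz eq_sym.
Qed.

Lemma setD_ex (T : finType) (A B : {set T}) : #|A| = #|B| -> A != B ->
  exists x, x \in A :\: B.
Proof.
move=> h AB; apply/set0Pn; rewrite setD_eq0; apply: contra AB => sAB.
by rewrite eqEcard sAB h leqnn.
Qed.

(** * Transfer to the circle *)

Unset Implicit Arguments.
Set Strict Implicit.

Theorem theorem3 (n r : nat) (hn : 1 <= n) (N : 'I_n -> {set 'I_n})
    (hN : necklace r N) (hNi : forall i : 'I_n, i \in N i)
    (X Y : {set 'I_n})
    (hX : X \in neck_out r N) (hY : Y \in neck_int r N) :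
  weakly_separated X Y.
Proof.
case: hN => hNr hNS.
move: hX; rewrite in_setD !in_set => /andP[Xint /andP[/eqP cX /forallP sepX]].
move: hY; rewrite in_set in_set => /andP[/eqP cY /forallP intY].
have cN i : #|N i| = r by apply/eqP; have := hNr i; rewrite in_set.
(* If X is some N_i, interiority of Y at [i] suffices; otherwise X differs from every N_k, so no
   difference is empty. *)
have [/existsP [i /eqP ->]|XN] := boolP [exists i, X == N i].
  by apply/existsP; exists i.
have {}XN i : X != N i by apply: contra XN => h; apply/existsP; exists i.
pose o := residue hn.
pose x_ k := o k \in X; pose y_ k := o k \in Y; pose m_ k x := o x \in N (o k).
have lostE k x : k <= x < k + n -> lost n x_ m_ k x = (o x \in X :\: N (o k)).
  by move=> h; rewrite /lost h in_setD [RHS]andbC.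
have extraE k x : k <= x < k + n -> extra n x_ m_ k x = (o x \in N (o k) :\: X).
  by move=> h; rewrite /extra h in_setD [RHS]andbC.
have winl k x : lost n x_ m_ k x -> k <= x < k + n by case/andP.
have wine k x : extra n x_ m_ k x -> k <= x < k + n by case/andP.
have oper k : o (k + n) = o k by apply: residue_per.
have [p hp] : exists p, forall u v, p <= u < p + n -> p <= v < p + n ->
    x_ u -> ~~ y_ u -> y_ v -> ~~ x_ v -> u < v.
  apply: (@outer_separates n x_ y_ m_).
  - by move=> x; rewrite /x_ oper.
  - by move=> k x; rewrite /m_ oper.
  - by move=> k x; rewrite /m_ oper.
  - by move=> k; apply: hNi.
  - move=> k x Mx kx; rewrite /m_ /o -ordS_residue.
    apply: (subsetP (hNS _)); rewrite in_setD1 andbC [_ \in _]Mx.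
    apply/eqP => /(residue_inj (k := k)) e.
    by have := e ltac:(lia) ltac:(lia); lia.
  - move=> k x y hx hy Mx My hx' hy'.
    have new z : k < z <= k + n -> m_ k.+1 z -> (z < k + n -> ~~ m_ k z) ->
        o z \in N (o k.+1) :\: (N (o k) :\ o k).
      move=> hz Mz hz'; rewrite in_setD [_ \in N _]Mz andbT.
      rewrite in_setD1 negb_and negbK.
      case: (ltnP z (k + n)) => zk; first by apply/orP; right; apply: hz'.
      have -> : z = k + n by lia.
      by rewrite oper eqxx.
    (* N_k without [k] has r - 1 elements, all of them in N_{k+1}. *)
    have card1 : #|N (o k.+1) :\: (N (o k) :\ o k)| = 1.
      have := hNS (o k); rewrite ordS_residue => /setIidPr sub.
      have := cardsD (N (o k.+1)) (N (o k) :\ o k); rewrite sub.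
      have := cardsD1 (o k) (N (o k)); rewrite hNi !cN => -> ->.
      by rewrite addnK.
    have /card_le1_eqP h1 : #|N (o k.+1) :\: (N (o k) :\ o k)| <= 1.
      by rewrite card1.
    have e : o x = o y by apply: h1; apply: new.
    by apply: (residue_inj (k := k.+1) _ _ e); lia.
  - move=> k; have [|z hz] := setD_ex (A := X) (B := N (o k)) _ (XN _).
      by rewrite cX cN.
    by have [x hx ex] := residue_surj hn k z; exists x; rewrite lostE // /o ex.
  - move=> k; have [||z hz] := setD_ex (A := N (o k)) (B := X).
    + by rewrite cX cN.
    + by rewrite eq_sym.
    by have [x hx ex] := residue_surj hn k z; exists x; rewrite extraE // /o ex.
  - move=> k x y z hx hy xy.
    have [hx' hy'] := (wine _ _ hx, wine _ _ hy).
    rewrite !extraE // in hx hy.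
    have [||t ht tz] := setD_ex_neq (o z) _ hx hy.
    + by rewrite cX cN.
    + by apply/eqP => /(residue_inj hx' hy').
    have [s hs es] := residue_surj hn k t.
    exists s; first by rewrite lostE // /o es.
    by move=> e; case/eqP: tz; rewrite -es e.
  - move=> k x y z hx hy xy.
    have [hx' hy'] := (winl _ _ hx, winl _ _ hy).
    rewrite !lostE // in hx hy.
    have [||t ht tz] := setD_ex_neq (o z) _ hx hy.
    + by rewrite cX cN.
    + by apply/eqP => /(residue_inj hx' hy').
    have [s hs es] := residue_surj hn k t.
    exists s; first by rewrite extraE // /o es.
    by move=> e; case/eqP: tz; rewrite -es e.
  - move=> k a b c d ha hb hc hd [/andP[ab bc] cd].
    have := (winl _ _ ha, wine _ _ hb, winl _ _ hc, wine _ _ hd).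
    case=> [[[wa wb] wc] wd]; rewrite ?lostE ?extraE // in ha hb hc hd.
    have cross := weakly_separated_uncrossed (n_gt0 := hn) (sepX (o k)).
    by apply: (cross k _ _ _ _ _ ab bc cd _ ha hb hc hd); lia.
  - move=> k a b c d ha hb hc hd [/andP[ab bc] cd].
    have := (wine _ _ ha, winl _ _ hb, wine _ _ hc, winl _ _ hd).
    case=> [[[wa wb] wc] wd]; rewrite ?lostE ?extraE // in ha hb hc hd.
    have cross := weakly_separated_uncrossed_r (n_gt0 := hn) (sepX (o k)).
    by apply: (cross k _ _ _ _ _ ab bc cd _ ha hb hc hd); lia.
  - move=> k x y hx hy Mx Yx Yy My.
    by have /cyc_llP := intY (o k); apply; rewrite // in_setD; apply/andP.
  (* If [x] were not in Y, equal sizes would give an element of Y - N_k, which must follow [x] in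
     the order at [k]; but [x] is last there. *)
  - move=> k x xk Mx; apply/negPn/negP => Yx.
    have [||z hz] := setD_ex (A := Y) (B := N (o k)).
    + by rewrite cY cN.
    + by apply: contra Yx => /eqP e; rewrite /y_ e.
    have [y hy ey] := residue_surj hn k z.
    have /cyc_llP/(_ x y) := intY (o k).
    rewrite ey hz in_setD [_ \notin _]Yx [_ \in _]Mx.
    by move=> /(_ ltac:(lia) hy isT isT); lia.
  - have /forallPn[i hi] : ~~ [forall i, cyc_ll i (N i) X].
      by move: Xint; rewrite cX eqxx.
    exists i; apply: contra hi => /innerP h.
    rewrite -[i in cyc_ll i](residue_val hn); apply/cyc_llP => x y hx hy Nx Xy.
    have ei : o i = i by apply: residue_val.
    by apply: h; rewrite ?lostE ?extraE // ei.
apply/existsP; exists (o p); apply/cyc_llP => u v hu hv.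
rewrite !in_setD => /andP[Yu Xu] /andP[Xv Yv].
exact: hp.
Qed.
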